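(* Let $H$ be a complex Hilbert space (of any dimension) and let $A_1,A_2,A_3,\ldots\in B(H)_{++}$. (i) If the partial products $P_N:=A_1A_2\cdots A_N$ converge in operator norm to an invertible operator $P$, then $$\operatorname{OLC}(P)\le\liminf_{N\to\infty}\sum_{k=1}^N\operatorname{OLC}(A_k);$$ if moreover the series $\sum_{k=1}^\infty\operatorname{OLC}(A_k)$ converges, then $\operatorname{OLC}(P)\le\sum_{k=1}^\infty\operatorname{OLC}(A_k)$. (ii) For the Cesàro means $S_N:=\frac1N\sum_{k=1}^NA_k$ one has $\operatorname{OLC}(S_N)\le\max_{1\le k\le N}\operatorname{OLC}(A_k)$ for every $N$; and if $S_N$ converges in operator norm to an invertible operator $A$, then $\operatorname{OLC}(A)\le\sup_{k\ge1}\operatorname{OLC}(A_k)$.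
   Context: $B(H)$ is the algebra of bounded operators on $H$ with operator norm $\|\cdot\|$; $B(H)_{++}$ is the set of positive invertible operators. For any invertible $A\in B(H)$, $\kappa(A):=\|A\|\,\|A^{-1}\|$ and $\operatorname{OLC}(A):=\tfrac12\ln\kappa(A)$. A supremum may equal $+\infty$. *)

(* Defs.v *)
From HB Require Import structures.
From mathcomp Require Import all_boot all_order all_algebra.
From mathcomp Require Import complex.
From mathcomp Require Import all_classical all_reals all_analysis.

Set Implicit Arguments.
Unset Strict Implicit.
Unset Printing Implicit Defensive.

Import Order.TTheory GRing.Theory Num.Theory.
Import numFieldNormedType.Exports.

Local Open Scope classical_set_scope.
Local Open Scope ring_scope.
Local Open Scope complex_scope.

(* The form is linear in its first argument and conjugate-linear in the
   second.  The norm takes its (real, nonnegative) values in R[i]. *)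
HB.mixin Record isHilbert (R : realType) H & CompleteNormedModule R[i] H := {
  inner : {dot H for Num.conj} ;
  inner_norm : forall x : H, inner x x = `|x| ^+ 2
}.

#[short(type="hilbertType")]
HB.structure Definition Hilbert (R : realType) :=
  {H of CompleteNormedModule R[i] H & isHilbert R H}.

Lemma real_complexD (R : realType) (a b : R) : (a + b)%:C = a%:C + b%:C.
Proof. exact: (rmorphD (real_complex R)). Qed.

Lemma real_complexM (R : realType) (a b : R) : (a * b)%:C = a%:C * b%:C.
Proof. exact: (rmorphM (real_complex R)). Qed.

Section BoundedOperators.
Variables (R : realType) (H : hilbertType R).

Definition bounded_operator (f : H -> H) :=
  linear f /\ exists M : R, forall x, `|f x| <= M%:C * `|x|.

Definition bop_pred : pred (H -> H) := fun f => `[< bounded_operator f >].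

Record bop := Bop { bop_fun :> H -> H ; _ : bop_fun \in bop_pred }.

HB.instance Definition _ := [isSub for bop_fun].
HB.instance Definition _ := [Choice of bop by <:].

Lemma bop_submod_closed : submod_closed bop_pred.
Proof.
split.
  apply/asboolP; split; first by move=> a x y; rewrite /= scaler0 addr0.
  by exists 0 => x /=; rewrite normr0 mul0r.
move=> a f g /asboolP[lf [M fM]] /asboolP[lg [N gN]]; apply/asboolP; split.
  move=> b x y.
  have E z : (a *: f + g) z = a *: f z + g z by [].
  rewrite !E lf lg !scalerDr !scalerA (mulrC a b) !addrA; congr (_ + _).
  by rewrite -!addrA; congr (_ + _); rewrite addrC.
exists (complex.Re `|a| * M + N) => x.
have E z : (a *: f + g) z = a *: f z + g z by [].
rewrite E (le_trans (ler_normD _ _))// normrZ.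
rewrite real_complexD real_complexM RRe_real ?normr_real// mulrDl -mulrA.
by rewrite lerD// ler_wpM2l.
Qed.

HB.instance Definition _ :=
  GRing.isSubmodClosed.Build R[i] (H -> H) bop_pred bop_submod_closed.
HB.instance Definition _ := [SubChoice_isSubLmodule of bop by <:].

Lemma bopP (A : bop) : bounded_operator A.
Proof. by case: A => f /= /asboolP. Qed.

Lemma bop_eqP (A B : bop) : A =1 B -> A = B.
Proof. by move=> AB; apply/val_inj/funext. Qed.

HB.instance Definition _ (A : bop) :=
  GRing.isLinear.Build R[i] H H *:%R A (bopP A).1.

Lemma bop0E x : (0 : bop) x = 0. Proof. by []. Qed.
Lemma bopDE (A B : bop) x : (A + B) x = A x + B x. Proof. by []. Qed.
Lemma bopZE a (A : bop) x : (a *: A) x = a *: A x. Proof. by []. Qed.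

Lemma bop_one_subproof : (id : H -> H) \in bop_pred.
Proof.
by apply/asboolP; split => //; exists 1 => x; rewrite rmorph1 mul1r.
Qed.
Definition bop_one := Bop bop_one_subproof.

Lemma bop_bound (A : bop) : exists2 M : R, 0 <= M &
  forall x, `|A x| <= M%:C * `|x|.
Proof.
have [_ [M AM]] := bopP A; exists `|M|; first exact: normr_ge0.
move=> x; rewrite (le_trans (AM x))// ler_wpM2r// lecR ler_norm//.
Qed.

Lemma bop_mul_subproof (A B : bop) : A \o B \in bop_pred.
Proof.
apply/asboolP; split; first by move=> a x y /=; rewrite !linearP.
have [M M0 AM] := bop_bound A; have [N N0 BN] := bop_bound B.
exists (M * N) => x /=; rewrite (le_trans (AM _))// real_complexM -mulrA.
by rewrite ler_wpM2l// ler0c.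
Qed.
Definition bop_mul (A B : bop) := Bop (bop_mul_subproof A B).

Let bop_mulA : associative bop_mul.
Proof. by move=> A B C; exact: bop_eqP. Qed.
Let bop_mul1 : left_id bop_one bop_mul.
Proof. by move=> A; exact: bop_eqP. Qed.
Let bop_mulr1 : right_id bop_one bop_mul.
Proof. by move=> A; exact: bop_eqP. Qed.
Let bop_mulDl : left_distributive bop_mul +%R.
Proof. by move=> A B C; exact: bop_eqP. Qed.
Let bop_mulDr : right_distributive bop_mul +%R.
Proof. by move=> A B C; apply: bop_eqP => x; exact: (raddfD A). Qed.

(* Not a nzRingType: H may be the zero space. *)
HB.instance Definition _ := GRing.Zmodule_isPzRing.Build bop
  bop_mulA bop_mul1 bop_mulr1 bop_mulDl bop_mulDr.

Lemma bop1E x : (1 : bop) x = x. Proof. by []. Qed.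
Lemma bopME (A B : bop) x : (A * B) x = A (B x). Proof. by []. Qed.

Definition opnorm (A : bop) : R :=
  sup [set complex.Re `|A x| | x in [set x : H | `|x| <= 1]].

Lemma opnorm_has_sup (A : bop) :
  has_sup [set complex.Re `|A x| | x in [set x : H | `|x| <= 1]].
Proof.
split; first by exists (complex.Re `|A 0|), 0 => //=; rewrite normr0.
have [M M0 AM] := bop_bound A; exists M => _ [x /= x1 <-].
rewrite -lecR RRe_real ?normr_real// (le_trans (AM x))//.
by rewrite ler_piMr// ler0c.
Qed.

Lemma opnorm_ge0 (A : bop) : 0 <= opnorm A.
Proof.
apply: ub_le_sup; first exact: (opnorm_has_sup A).2.
by exists 0; rewrite /= ?normr0// linear0 normr0.
Qed.

Lemma le_opnorm (A : bop) (x : H) : `|A x| <= (opnorm A)%:C * `|x|.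
Proof.
have [->|x0] := eqVneq x 0; first by rewrite linear0 !normr0 mulr0.
have nx : 0 < `|x| by rewrite normr_gt0.
rewrite -ler_pdivrMr// mulrC.
have -> : `|x|^-1 * `|A x| = `|A (`|x|^-1 *: x)|.
  by rewrite linearZ normrZ normfV normr_id.
rewrite -(@RRe_real _ `|A _|) ?normr_real// lecR.
apply: ub_le_sup; first exact: (opnorm_has_sup A).2.
by exists (`|x|^-1 *: x) => //=; rewrite normrZ normfV normr_id mulVf// gt_eqF.
Qed.

Lemma opnorm_le (A : bop) (M : R) : 0 <= M -> (forall x, `|A x| <= M%:C * `|x|) ->
  opnorm A <= M.
Proof.
move=> M0 AM; apply: ge_sup; first exact: (opnorm_has_sup A).1.
move=> _ [x /= x1 <-]; rewrite -lecR RRe_real ?normr_real//.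
by rewrite (le_trans (AM x))// ler_piMr// ler0c.
Qed.

Let bop_normD (A B : bop) :
  (opnorm (A + B))%:C <= (opnorm A)%:C + (opnorm B)%:C.
Proof.
rewrite -real_complexD lecR opnorm_le ?addr_ge0 ?opnorm_ge0// => x.
rewrite bopDE (le_trans (ler_normD _ _))// real_complexD mulrDl.
by rewrite lerD// le_opnorm.
Qed.

Let bop_normZ_le (a : R[i]) (A : bop) :
  (opnorm (a *: A))%:C <= `|a| * (opnorm A)%:C.
Proof.
rewrite -(@RRe_real _ `|a|) ?normr_real// -real_complexM lecR.
have a0 : 0 <= complex.Re `|a| by rewrite -ler0c RRe_real ?normr_real.
rewrite opnorm_le ?mulr_ge0 ?opnorm_ge0// => x.
rewrite bopZE normrZ real_complexM RRe_real ?normr_real// -mulrA.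
by rewrite ler_wpM2l// le_opnorm.
Qed.

Let bop_normZ (a : R[i]) (A : bop) :
  (opnorm (a *: A))%:C = `|a| * (opnorm A)%:C.
Proof.
apply/le_anti; rewrite bop_normZ_le/=.
have [->|a0] := eqVneq a 0.
  by rewrite normr0 mul0r ler0c opnorm_ge0.
have := bop_normZ_le a^-1 (a *: A).
rewrite scalerA mulVf// scale1r normfV.
by rewrite mulrC ler_pdivlMr ?normr_gt0// mulrC.
Qed.

Let bop_norm0_eq0 (A : bop) : (opnorm A)%:C = 0 -> A = 0.
Proof.
move=> A0; apply: bop_eqP => x; apply/eqP.
by rewrite bop0E -normr_le0 (le_trans (le_opnorm A x))// A0 mul0r.
Qed.

HB.instance Definition _ := Lmodule_isNormed.Build R[i] bop
  bop_normD bop_normZ bop_norm0_eq0.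

Lemma bop_normE (A : bop) : `|A| = (opnorm A)%:C. Proof. by []. Qed.

Definition invertible (A : bop) := exists B : bop, A * B = 1 /\ B * A = 1.

(* The two-sided inverse, and 0 if there is none. *)
Definition bop_inv (A : bop) : bop :=
  xget 0 [set B : bop | A * B = 1 /\ B * A = 1].

(* On R[i], 0 <= z entails that z is real. *)
Definition positive (A : bop) := forall x, 0 <= inner (A x) x.

Definition Bpp : set bop := [set A | positive A /\ invertible A].

Definition kappa (A : bop) : R := opnorm A * opnorm (bop_inv A).

(* On the zero space kappa A = 0 and ln 0 = 0, so that OLC A = 0. *)
Definition OLC (A : bop) : R := 2^-1 * ln (kappa A).

End BoundedOperators.

(* Main.v *)
(* For invertible A and c >= 0, OLC A <= c means |A x| |y| <= e^(2c) |A y| |x|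
   for all x and y, a condition preserved by pointwise limits; so no continuity of
   inversion is needed.  Part (i) follows from kappa (A B) <= kappa A * kappa B,
   as the partial sums of the nonnegative numbers OLC (A_k) are nondecreasing.
   For part (ii), A in B(H)_++ satisfies |A| |x|^2 <= kappa A <A x, x>.  If all
   kappa (A_k) <= K, summing gives a |x|^2 <= K <T x, x> for T = A_1 + ... + A_N
   and a = |A_1| + ... + |A_N| >= |T|; hence T is invertible and kappa T <= K. *)
Require Import Defs.
From HB Require Import structures.
From mathcomp Require Import all_boot all_order all_algebra.
From mathcomp Require Import complex.
From mathcomp Require Import all_classical all_reals all_analysis.
From mathcomp Require Import ring lra.

Set Implicit Arguments.
Unset Strict Implicit.
Unset Printing Implicit Defensive.

Import Order.TTheory GRing.Theory Num.Theory.
Import numFieldNormedType.Exports.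

Local Open Scope classical_set_scope.
Local Open Scope ring_scope.
Local Open Scope complex_scope.

(** * Real-valued norms on normed spaces over [R[i]] *)

Section RealNorm.
Variables (R : realType) (V : normedModType R[i]).

(** The norm lives in [R[i]], which is only partially ordered; its real part allows real arithmetic
    with [lra] and [nra]. *)
Definition rnorm (x : V) : R := complex.Re `|x|.

Lemma rnormE x : `|x| = (rnorm x)%:C.
Proof. by rewrite /rnorm RRe_real ?normr_real. Qed.

Lemma rnorm_ge0 x : 0 <= rnorm x.
Proof. by rewrite -ler0c -rnormE. Qed.

Lemma rnorm0 : rnorm 0 = 0.
Proof. by rewrite /rnorm normr0. Qed.

Lemma rnorm_eq0 x : rnorm x = 0 -> x = 0.
Proof. by move=> x0; apply: normr0_eq0; rewrite rnormE x0. Qed.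

Lemma rnormN x : rnorm (- x) = rnorm x.
Proof. by rewrite /rnorm normrN. Qed.

Lemma rnormB x y : rnorm (x - y) = rnorm (y - x).
Proof. by rewrite /rnorm distrC. Qed.

Lemma rnormD x y : rnorm (x + y) <= rnorm x + rnorm y.
Proof. by rewrite -lecR real_complexD -!rnormE ler_normD. Qed.

Lemma rnormZ (t : R) x : 0 <= t -> rnorm (t%:C *: x) = t * rnorm x.
Proof.
move=> t0; apply: complexI; rewrite real_complexM -!rnormE normrZ.
by rewrite ger0_norm// ler0c.
Qed.

Lemma rnorm_sum (I : Type) (r : seq I) (F : I -> V) :
  rnorm (\sum_(i <- r) F i) <= \sum_(i <- r) rnorm (F i).
Proof.
elim: r => [|i r ih]; first by rewrite !big_nil rnorm0.
by rewrite !big_cons (le_trans (rnormD _ _))// lerD2l.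
Qed.

Lemma cvg_rnorm_lt (u : nat -> V) (l : V) : u n @[n --> \oo] --> l ->
  forall e : R, 0 < e -> \forall n \near \oo, rnorm (l - u n) < e.
Proof.
move=> /cvgrPdist_lt ul e e0; have e0c : 0 < e%:C by rewrite ltcR.
apply: filterS (ul _ e0c) => n.
by rewrite rnormE ltcR.
Qed.

End RealNorm.

(** * Fixed points of contractions over complex scalars *)

Section Contraction.
Variables (R : realType) (V : completeNormedModType R[i]).

(* The library's banach_fixed_point is restricted to real scalars. *)
Lemma contraction_fixpoint (f : V -> V) (q : R) : 0 <= q -> q < 1 ->
  (forall x y, rnorm (f x - f y) <= q * rnorm (x - y)) -> exists p, f p = p.
Proof.
move=> q0 q1 fq; pose y n := iter n f 0.
(* [D] solves [rnorm (f 0) + q * D = D], so the ball of radius [D] about 0 is stable under [f] and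
   contains every iterate. *)
pose D := rnorm (f 0) / (1 - q).
have q1' : 0 < 1 - q by rewrite subr_gt0.
have D0 : 0 <= D by rewrite divr_ge0 ?rnorm_ge0 ?ltW.
have ybnd m : rnorm (y m) <= D.
  elim: m => [|m ih]; first by rewrite /= rnorm0.
  have -> : y m.+1 = (f (y m) - f 0) + f 0 by rewrite subrK.
  rewrite (le_trans (rnormD _ _))//.
  have := fq (y m) 0; rewrite subr0 => /le_trans-/(_ _ (ler_wpM2l q0 ih)) h.
  have : rnorm (f 0) = (1 - q) * D by rewrite /D mulrC divfK// gt_eqF.
  move: h; lra.
have ydist m n : rnorm (y (n + m)%N - y n) <= q ^+ n * D.
  elim: n => [|n ih]; first by rewrite add0n subr0 expr0 mul1r.
  rewrite addSn (le_trans (fq _ _))// exprS -mulrA.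
  exact: ler_wpM2l.
have [p yp] : exists p : V, y n @[n --> \oo] --> p.
  apply/cvg_ex/cauchy_cvgP/cauchyP => e /=.
  (* The radius is a positive element of [R[i]], hence has zero imaginary part. *)
  case: e => [e e'] ; rewrite ltcE /= => /andP[/eqP -> e0].
  have /cvgrPdist_lt/(_ _ e0)[N _ Ne] : geometric D q @ \oo --> 0.
    by apply: cvg_geometric; rewrite ger0_norm.
  exists (y N); exists N => // n /= Nn.
  rewrite -ball_normE /= rnormE ltcR rnormB -(subnKC Nn).
  rewrite (le_lt_trans (ydist _ _))// mulrC.
  have := Ne N (leqnn N); rewrite /= sub0r normrN; apply: le_lt_trans.
  exact: ler_norm.
exists p; apply: subr0_eq; apply: rnorm_eq0; apply: le_anti; rewrite rnorm_ge0 andbT.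
apply/ler_addgt0Pr => e e0; rewrite add0r.
have [N _ Ne] := cvg_rnorm_lt yp (divr_gt0 e0 (ltr0n _ 2)).
have h1 := Ne N (leqnn N); have h2 := Ne N.+1 (leqnSn N).
have -> : f p - p = (f p - f (y N)) + (y N.+1 - p) by rewrite addrA subrK.
rewrite (le_trans (rnormD _ _))// [e]splitr lerD// ltW//; last by rewrite rnormB.
apply: le_lt_trans h1; apply: le_trans (fq _ _) _.
by rewrite ler_piMl ?rnorm_ge0// ltW.
Qed.

End Contraction.

(** * The real part of the inner product, Cauchy-Schwarz, and symmetry of positive operators *)

Section RealInner.
Variables (R : realType) (H : hilbertType R).
Implicit Types (x y z : H) (A B : bop H).

Definition rinner x y : R := complex.Re (inner x y).

Lemma rinnerDl x y z : rinner (x + y) z = rinner x z + rinner y z.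
Proof. by rewrite /rinner linearDl raddfD. Qed.

Lemma rinnerDr x y z : rinner x (y + z) = rinner x y + rinner x z.
Proof. by rewrite /rinner linearDr raddfD. Qed.

Lemma rinnerNl x y : rinner (- x) y = - rinner x y.
Proof. by rewrite /rinner linearNl raddfN. Qed.

Lemma rinnerNr x y : rinner x (- y) = - rinner x y.
Proof. by rewrite /rinner linearNr raddfN. Qed.

Lemma rinnerZl (t : R) x y : rinner (t%:C *: x) y = t * rinner x y.
Proof. by rewrite /rinner linearZl_LR /=; case: (inner x y) => a b /=; ring. Qed.

Lemma rinnerC x y : rinner x y = rinner y x.
Proof.
rewrite /rinner hermC /= expr0 mul1r.
by case: (inner y x).
Qed.

Lemma rinnerZr (t : R) x y : rinner x (t%:C *: y) = t * rinner x y.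
Proof. by rewrite rinnerC rinnerZl rinnerC. Qed.

Lemma rinner_norm x : rinner x x = rnorm x ^+ 2.
Proof. by rewrite /rinner inner_norm rnormE -rmorphXn. Qed.

(** Cauchy-Schwarz: the squared norm of |y| x - |x| y equals 2 |x| |y| (|x| |y| - Re <x, y>). *)
Lemma rinner_le x y : rinner x y <= rnorm x * rnorm y.
Proof.
have [x0|x0] := eqVneq (rnorm x) 0.
  by rewrite x0 mul0r (rnorm_eq0 x0) /rinner linear0l.
have [y0|y0] := eqVneq (rnorm y) 0.
  by rewrite y0 mulr0 (rnorm_eq0 y0) /rinner linear0r.
have xy : 0 < rnorm x * rnorm y by rewrite mulr_gt0// lt_def rnorm_ge0 ?x0 ?y0.
have := sqr_ge0 (rnorm ((rnorm y)%:C *: x - (rnorm x)%:C *: y)).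
rewrite -rinner_norm !(rinnerDl, rinnerDr, rinnerNl, rinnerNr, rinnerZl, rinnerZr).
rewrite !rinner_norm (rinnerC y x) => h.
rewrite -subr_ge0 -(pmulr_rge0 _ xy).
move: h; nra.
Qed.

Lemma rnorm_opnorm A x : rnorm (A x) <= opnorm A * rnorm x.
Proof. by rewrite -lecR real_complexM -!rnormE le_opnorm. Qed.

Lemma opnorm_le_rnorm A (M : R) : 0 <= M ->
  (forall x, rnorm (A x) <= M * rnorm x) -> opnorm A <= M.
Proof.
move=> M0 AM; apply: opnorm_le => // x.
by rewrite !rnormE -real_complexM lecR.
Qed.

Lemma rnorm_bopE A : rnorm A = opnorm A.
Proof. by []. Qed.

Lemma opnormM A B : opnorm (A * B) <= opnorm A * opnorm B.
Proof.
apply: opnorm_le_rnorm => [|x]; first by rewrite mulr_ge0 ?opnorm_ge0.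
rewrite bopME (le_trans (rnorm_opnorm _ _))// -mulrA ler_wpM2l ?opnorm_ge0//.
exact: rnorm_opnorm.
Qed.

Lemma positive_rinner_ge0 A x : positive A -> 0 <= rinner (A x) x.
Proof. by move=> /(_ x); rewrite lecE => /andP[]. Qed.

(* The imaginary part of <A z, z> at z = 'i y + x is Re <A y, x> - Re <A x, y>. *)
Lemma positive_rinnerC A x y : positive A -> rinner (A x) y = rinner (A y) x.
Proof.
move=> A0; have := ger0_Im (A0 ('i *: y + x)).
have := ger0_Im (A0 x); have := ger0_Im (A0 y).
rewrite (bopP A).1 !(linearDl, linearDr) !linearZl_LR /= !linearZr_LR /=.
rewrite /rinner.
case: (inner (A x) x) => a1 b1; case: (inner (A x) y) => a2 b2.
case: (inner (A y) x) => a3 b3; case: (inner (A y) y) => a4 b4 /=.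
lra.
Qed.

End RealInner.

(** * Condition numbers: inverse-free characterisation, products, limits *)

Section ConditionNumber.
Variables (R : realType) (H : hilbertType R).
Implicit Types (x y : H) (A B : bop H).

Lemma bop_invP A : invertible A -> A * bop_inv A = 1 /\ bop_inv A * A = 1.
Proof.
move=> [B AB]; apply: (xgetPex 0 (P := [set B | A * B = 1 /\ B * A = 1])).
by exists B.
Qed.

Lemma bop_invl A x : invertible A -> bop_inv A (A x) = x.
Proof. by move=> /bop_invP[_ BA]; rewrite -bopME BA. Qed.

Lemma bop_invr A x : invertible A -> A (bop_inv A x) = x.
Proof. by move=> /bop_invP[AB _]; rewrite -bopME AB. Qed.

Lemma bop_inv_unique A B : A * B = 1 -> B * A = 1 -> bop_inv A = B.
Proof.
move=> AB BA; have [_ IA] : A * bop_inv A = 1 /\ bop_inv A * A = 1.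
  by apply: bop_invP; exists B.
by rewrite -[LHS]mulr1 -AB mulrA IA mul1r.
Qed.

Lemma invertibleM A B : invertible A -> invertible B -> invertible (A * B).
Proof.
move=> [A' [AA' A'A]] [B' [BB' B'B]]; exists (B' * A'); split.
  by rewrite mulrA -(mulrA A) BB' mulr1.
by rewrite mulrA -(mulrA B') A'A mulr1.
Qed.

Lemma invertible1 : invertible (1 : bop H).
Proof. by exists 1; rewrite mulr1. Qed.

Lemma kappa_ge0 A : 0 <= kappa A.
Proof. by rewrite mulr_ge0 ?opnorm_ge0. Qed.

(* kappa A = 0 only occurs on the zero space. *)
Lemma kappa_eq0_or_ge1 A : invertible A -> kappa A = 0 \/ 1 <= kappa A.
Proof.
move=> Ai; have [[x /eqP x0]|H0] := pselect (exists x : H, x <> 0); [right|left].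
  have nx : 0 < rnorm x.
    by rewrite lt_def rnorm_ge0 andbT; apply: contra_neq x0; exact: rnorm_eq0.
  rewrite -(ler_pM2r nx) mul1r -{1}(bop_invr x Ai).
  rewrite (le_trans (rnorm_opnorm _ _))// /kappa -mulrA ler_wpM2l ?opnorm_ge0//.
  exact: rnorm_opnorm.
have z x : x = 0 by apply: contra_notP H0 => x0; exists x.
suff -> : kappa A = 0 * opnorm (bop_inv A) by rewrite mul0r.
congr (_ * _); apply/le_anti; rewrite opnorm_ge0 andbT.
by apply: opnorm_le_rnorm => // x; rewrite mul0r (z (A x)) rnorm0.
Qed.

Lemma OLC_ge0 A : invertible A -> 0 <= OLC A.
Proof.
move=> /kappa_eq0_or_ge1[k0|k1]; first by rewrite /OLC k0 ln0// mulr0.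
by rewrite mulr_ge0 ?invr_ge0// ln_ge0.
Qed.

(** The condition [0 <= c] covers the zero space, where [kappa A = 0] and [OLC A = 0] make both
    sides true. *)
Lemma OLC_le_kappa A (c : R) : invertible A -> 0 <= c ->
  (OLC A <= c) = (kappa A <= expR (2 * c)).
Proof.
move=> /kappa_eq0_or_ge1[k0|k1] c0.
  by rewrite /OLC k0 ln0// mulr0 c0 expR_ge0.
have kp : 0 < kappa A by exact: lt_le_trans k1.
by rewrite -[in RHS](@lnK _ (kappa A))// ler_expR /OLC mulrC ler_pdivrMr// mulrC.
Qed.

(** Forwards, multiply |A x| <= |A| |x| by |y| <= |A^-1| |A y|. Backwards, put A^-1 y for y and take
    the two operator norms one after the other, dividing each time by the other factor once it is
    known to be nonzero. *)
Lemma kappa_leP A (K : R) : invertible A -> 0 <= K ->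
  kappa A <= K <->
  forall x y, rnorm (A x) * rnorm y <= K * (rnorm (A y) * rnorm x).
Proof.
move=> Ai K0; split=> [kK x y|h].
  apply: le_trans (_ : kappa A * (rnorm (A y) * rnorm x) <= _); last first.
    by rewrite ler_wpM2r// mulr_ge0 ?rnorm_ge0.
  have yA : rnorm y <= opnorm (bop_inv A) * rnorm (A y).
    by rewrite -{1}(bop_invl y Ai) rnorm_opnorm.
  rewrite /kappa (mulrC (rnorm (A y))) -mulrACA.
  by rewrite ler_pM ?rnorm_ge0// rnorm_opnorm.
rewrite /kappa mulrC.
have [b0|b0] := eqVneq (opnorm (bop_inv A)) 0; first by rewrite b0 mul0r.
have bp : 0 < opnorm (bop_inv A) by rewrite lt_def b0 opnorm_ge0.
rewrite -ler_pdivlMl//.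
apply: opnorm_le_rnorm => [|x]; first by rewrite mulr_ge0// invr_ge0 ltW.
rewrite -mulrA ler_pdivlMl// mulrC.
have [a0|a0] := eqVneq (rnorm (A x)) 0.
  by rewrite a0 mul0r mulr_ge0 ?rnorm_ge0.
have ap : 0 < rnorm (A x) by rewrite lt_def a0 rnorm_ge0.
rewrite -ler_pdivlMl//; apply: opnorm_le_rnorm => [|y].
  by rewrite mulr_ge0 ?invr_ge0 ?rnorm_ge0// mulr_ge0 ?rnorm_ge0.
rewrite -mulrA ler_pdivlMl//; have := h x (bop_inv A y).
by rewrite bop_invr// mulrAC mulrA.
Qed.

Lemma OLC_leP A (c : R) : invertible A -> 0 <= c ->
  OLC A <= c <->
  forall x y, rnorm (A x) * rnorm y <= expR (2 * c) * (rnorm (A y) * rnorm x).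
Proof. by move=> Ai c0; rewrite OLC_le_kappa//; apply: kappa_leP; rewrite ?expR_ge0. Qed.

Lemma kappaM A B : invertible A -> invertible B ->
  kappa (A * B) <= kappa A * kappa B.
Proof.
move=> Ai Bi; have [AA' A'A] := bop_invP Ai; have [BB' B'B] := bop_invP Bi.
have -> : kappa (A * B) = opnorm (A * B) * opnorm (bop_inv B * bop_inv A).
  congr (_ * opnorm _); apply: bop_inv_unique.
    by rewrite mulrA -(mulrA A) BB' mulr1.
  by rewrite mulrA -(mulrA (bop_inv B)) A'A mulr1.
rewrite /kappa mulrACA (mulrC (opnorm (bop_inv A))).
by rewrite ler_pM ?opnorm_ge0// opnormM.
Qed.

Lemma OLCM A B : invertible A -> invertible B -> OLC (A * B) <= OLC A + OLC B.
Proof.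
move=> Ai Bi; have AB := invertibleM Ai Bi.
rewrite OLC_le_kappa ?addr_ge0 ?OLC_ge0// mulrDr expRD.
apply: le_trans (kappaM Ai Bi) _.
by rewrite ler_pM ?kappa_ge0// -OLC_le_kappa ?OLC_ge0.
Qed.

Lemma OLC1 : OLC (1 : bop H) = 0.
Proof.
apply/le_anti; rewrite OLC_ge0 ?andbT; last exact: invertible1.
apply/OLC_leP => //; first exact: invertible1.
by move=> x y; rewrite mulr0 expR0 mul1r mulrC.
Qed.

Lemma OLC_prod (A : nat -> bop H) N : (forall k, invertible (A k)) ->
  invertible (\prod_(k < N) A k) /\
  OLC (\prod_(k < N) A k) <= \sum_(k < N) OLC (A k).
Proof.
move=> Ai; elim: N => [|N [ih1 ih2]].
  by rewrite !big_ord0 OLC1; split=> //; exact: invertible1.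
rewrite !big_ord_recr; split; first exact: invertibleM.
by apply: le_trans (OLCM _ _) _ => //; rewrite lerD2r.
Qed.

Lemma OLC_limit (T : nat -> bop H) (T0 : bop H) (c : R) : 0 <= c ->
  (\forall n \near \oo, invertible (T n) /\ OLC (T n) <= c) ->
  T n @[n --> \oo] --> T0 -> invertible T0 -> OLC T0 <= c.
Proof.
move=> c0 Tc TT0 Ti0; apply/OLC_leP => // x y.
set K := expR (2 * c); have K0 : 0 <= K by exact: expR_ge0.
(* Replacing [T0] by [T n] within distance [d] costs d |x| |y| on the left and K d |x| |y| on the
   right, [d * E] in total. Since [E] may vanish, [d] is [e / (E + 1)]. *)
pose E := (1 + K) * (rnorm x * rnorm y).
have E0 : 0 <= E by rewrite mulr_ge0 ?addr_ge0// mulr_ge0 ?rnorm_ge0.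
apply/ler_addgt0Pr => e e0; pose d := e / (E + 1).
have d0 : 0 < d by rewrite divr_gt0// ltr_wpDl.
near \oo => n.
have [Tn Tnc] : invertible (T n) /\ OLC (T n) <= c by near: n.
have dn : rnorm (T0 - T n) < d.
  by near: n; exact: cvg_rnorm_lt.
have bnd z : rnorm ((T0 - T n) z) <= d * rnorm z.
  apply: le_trans (rnorm_opnorm _ _) _.
  by rewrite ler_wpM2r ?rnorm_ge0// -rnorm_bopE ltW.
have h1 : rnorm (T0 x) <= rnorm (T n x) + d * rnorm x.
  have -> : T0 x = T n x + (T0 - T n) x by rewrite bopDE addrC subrK.
  by rewrite (le_trans (rnormD _ _))// lerD2l.
have h2 : rnorm (T n y) <= rnorm (T0 y) + d * rnorm y.
  have -> : T n y = T0 y - (T0 - T n) y by rewrite bopDE opprD addrA subrr sub0r opprK.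
  by rewrite (le_trans (rnormD _ _))// rnormN lerD2l.
have h3 := (OLC_leP Tn c0).1 Tnc x y; rewrite -/K in h3.
have h4 := ler_wpM2r (rnorm_ge0 y) h1.
have h5 := ler_wpM2l K0 (ler_wpM2r (rnorm_ge0 x) h2).
have h6 : d * E <= e.
  by rewrite /d -mulrA ler_piMr ?ltW// mulrC ltr_pdivrMr ?ltr_wpDl// mul1r ltrDl.
by move: h3 h4 h5 h6; rewrite /E; nra.
Unshelve. all: by end_near. Qed.

End ConditionNumber.

(** * Coercive operators are invertible, and operators in [Bpp] are coercive *)

Section Coercive.
Variables (R : realType) (H : hilbertType R).
Implicit Types (x y : H) (A B : bop H).

Lemma rnorm_coercive A (m : R) x :
  m * rnorm x ^+ 2 <= rinner (A x) x -> m * rnorm x <= rnorm (A x).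
Proof.
move=> h; have [->|x0] := eqVneq (rnorm x) 0; first by rewrite mulr0 rnorm_ge0.
have xp : 0 < rnorm x by rewrite lt_def x0 rnorm_ge0.
rewrite -(ler_pM2r xp) -mulrA -expr2; exact: le_trans h (rinner_le _ _).
Qed.

(** Lax-Milgram argument: A x = y means that x is a fixed point of x - t (A x - y), which is a
    contraction for small t > 0. *)
Lemma coercive_invertible A (m : R) : 0 < m ->
  (forall x, m * rnorm x ^+ 2 <= rinner (A x) x) -> invertible A.
Proof.
move=> m0 Am.
have Ainj x y : A x = A y -> x = y.
  move=> Axy; apply: subr0_eq; apply: rnorm_eq0; apply: le_anti.
  rewrite rnorm_ge0 andbT -(pmulr_rle0 _ m0).
  by rewrite (le_trans (rnorm_coercive (Am _)))// (raddfB A) /= Axy subrr rnorm0.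
(* With [t * M ^+ 2 = m], the bound 1 - 2 t m + t^2 M^2 on the squared contraction factor becomes 1
   - t m. Adding [m] to the norm ensures M >= m, hence t m <= 1, so the square root below is
   genuine. *)
pose M := opnorm A + m; have M0 : 0 < M by rewrite ltr_wpDl ?opnorm_ge0.
pose t := m / M ^+ 2; have t0 : 0 < t by rewrite divr_gt0// exprn_gt0.
have tm1 : t * m <= 1.
  rewrite /t mulrAC -expr2 ler_pdivrMr ?exprn_gt0// mul1r.
  by rewrite ler_sqr ?nnegrE ?(ltW m0) ?(ltW M0)// /M lerDr opnorm_ge0.
have tM : t * M ^+ 2 = m by rewrite /t divfK// expf_neq0// gt_eqF.
have Asurj y : exists x, A x = y.
  pose f x := x - t%:C *: (A x - y).
  have q1 : Num.sqrt (1 - t * m) < 1.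
    by rewrite -[ltRHS]sqrtr1 ltr_sqrt// ltrBlDr ltrDl mulr_gt0.
  have [u v|p fp] := @contraction_fixpoint _ _ f _ (sqrtr_ge0 (1 - t * m)) q1.
    have -> : f u - f v = (u - v) - t%:C *: A (u - v).
      have -> : A (u - v) = (A u - y) - (A v - y).
        by rewrite (raddfB A) /= opprB addrA subrK.
      rewrite /f; move: (A u - y) (A v - y) => a b.
      by rewrite scalerBr !opprB addrACA [RHS]addrACA (addrC (- v)).
    move: (u - v) => d.
    rewrite -ler_sqr ?nnegrE ?mulr_ge0 ?sqrtr_ge0 ?rnorm_ge0//.
    rewrite exprMn sqr_sqrtr ?subr_ge0// -rinner_norm.
    rewrite !(rinnerDl, rinnerDr, rinnerNl, rinnerNr, rinnerZl, rinnerZr).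
    rewrite !rinner_norm (rinnerC d).
    have h1 : rnorm (A d) ^+ 2 <= M ^+ 2 * rnorm d ^+ 2.
      rewrite -exprMn ler_sqr ?nnegrE ?mulr_ge0 ?rnorm_ge0 ?(ltW M0)//.
      by rewrite (le_trans (rnorm_opnorm _ _))// ler_wpM2r ?rnorm_ge0// /M lerDl ltW.
    have h2 := ler_wpM2l (ltW t0) (Am d).
    have h3 := ler_wpM2l (ltW t0) (ler_wpM2l (ltW t0) h1).
    rewrite (mulrA t (M ^+ 2)) tM in h3.
    move: h2 h3; lra.
  exists p; apply: subr0_eq.
  have : t%:C *: (A p - y) = p - f p by rewrite subKr.
  rewrite fp subrr => /eqP; rewrite scaler_eq0 => /orP[|/eqP//].
  by rewrite gt_eqF// ltcR.
(* Injectivity of [A] makes the chosen right inverse linear and two-sided; coercivity bounds it by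
   [m^-1]. *)
have [g Ag] := choice Asurj.
have gP : g \in @bop_pred R H.
  apply/asboolP; split.
    by move=> a x y; apply: Ainj; rewrite (bopP A).1 !Ag.
  exists m^-1 => x; rewrite !rnormE -real_complexM lecR ler_pdivlMl//.
  by rewrite -{2}(Ag x) rnorm_coercive.
exists (Bop gP); split; apply: bop_eqP => x; first by rewrite bopME /= Ag.
by apply: Ainj; rewrite bopME /= Ag.
Qed.

(* Positivity of A at the vector |B| x - B x, where B is the inverse of A. *)
Lemma Bpp_coercive A x : Bpp A ->
  opnorm A * rnorm x ^+ 2 <= kappa A * rinner (A x) x.
Proof.
move=> [Apos Ai]; rewrite /kappa -mulrA ler_wpM2l ?opnorm_ge0//.
set B := bop_inv A; set b := opnorm B.
have ABx : A (B x) = x by exact: bop_invr.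
have bx : rnorm (B x) <= b * rnorm x by exact: rnorm_opnorm.
have [b0|b0] := eqVneq b 0.
  move: bx; rewrite b0 mul0r => bx.
  have Bx0 : B x = 0 by apply: rnorm_eq0; apply: le_anti; rewrite rnorm_ge0 bx.
  by rewrite -ABx Bx0 linear0 rnorm0 expr0n mul0r.
have bp : 0 < b by rewrite lt_def b0 opnorm_ge0.
(* This expands to b^2 <A x, x> - 2 b |x|^2 + <x, B x> >= 0. Since <x, B x> <= b |x|^2, dividing by
   b leaves |x|^2 <= b <A x, x>. *)
have := positive_rinner_ge0 (b%:C *: x - B x) Apos.
rewrite (raddfB A) /= (linearZ_LR A) /= ABx.
rewrite !(rinnerDl, rinnerDr, rinnerNl, rinnerNr, rinnerZl, rinnerZr).
rewrite (positive_rinnerC x (B x) Apos) ABx rinner_norm => h.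
have h1 : rinner x (B x) <= b * rnorm x ^+ 2.
  apply: le_trans (rinner_le _ _) _.
  by rewrite mulrC expr2 mulrA ler_wpM2r ?rnorm_ge0.
rewrite -(ler_pM2l bp); move: h h1; lra.
Qed.

End Coercive.

(** * Condition numbers of sums and means of positive operators *)

Section CesaroMean.
Variables (R : realType) (H : hilbertType R).
Implicit Types (A : nat -> bop H) (N : nat) (c : R).

(** Positivity of <A_k x, x> lets the common bound [expR (2 * c)] replace each [kappa (A k)]; the
    inequalities can then be added. *)
Lemma sum_Bpp_coercive A N c (x : H) : (forall k, Bpp (A k)) ->
  (forall k, (k < N)%N -> OLC (A k) <= c) -> 0 <= c ->
  (\sum_(k < N) opnorm (A k)) * rnorm x ^+ 2 <=
  expR (2 * c) * rinner ((\sum_(k < N) A k) x) x.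
Proof.
move=> hA Ac c0; elim: N Ac => [|n ih] An.
  by rewrite !big_ord0 mul0r bop0E /rinner linear0l mulr0.
have -> : (\sum_(k < n.+1) A k) x = (\sum_(k < n) A k) x + A n x.
  by rewrite big_ord_recr.
rewrite big_ord_recr /= rinnerDl mulrDl mulrDr lerD ?ih//.
  by move=> k kn; apply: An; rewrite ltnS ltnW.
apply: le_trans (Bpp_coercive _ (hA n)) _.
apply: ler_wpM2r; first exact: positive_rinner_ge0 (hA n).1.
by rewrite -(OLC_le_kappa (hA n).2 c0) An.
Qed.

(** The bounds |T x| <= a |x| and a |y| <= K |T y| share the constant a, so together they give the
    criterion of [OLC_leP]; the factor 1/N occurs on both sides and cancels. *)
Lemma OLC_cesaro_le A N c : (forall k, Bpp (A k)) ->
  (forall k, (k < N)%N -> OLC (A k) <= c) -> (0 < N)%N ->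
  invertible ((N%:R^-1 : R[i]) *: \sum_(k < N) A k) /\
  OLC ((N%:R^-1 : R[i]) *: \sum_(k < N) A k) <= c.
Proof.
move=> hA Ac N0; have c0 : 0 <= c by apply: le_trans (Ac 0%N N0); exact: OLC_ge0 (hA 0%N).2.
have K0 : 0 < expR (2 * c) by exact: expR_gt0.
set T := \sum_(k < N) A k; set s : R := N%:R^-1.
have s0 : 0 < s by rewrite invr_gt0 ltr0n.
have -> : (N%:R^-1 : R[i]) = s%:C by rewrite fmorphV rmorph_nat.
pose a := \sum_(k < N) opnorm (A k).
have Tcoer x : a * rnorm x ^+ 2 <= expR (2 * c) * rinner (T x) x.
  exact: sum_Bpp_coercive.
have Tle x : rnorm (T x) <= a * rnorm x.
  apply: le_trans (rnorm_opnorm _ _) _; rewrite ler_wpM2r ?rnorm_ge0//.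
  by rewrite -rnorm_bopE; exact: rnorm_sum.
have Sinv : invertible (s%:C *: T).
  (* If a = 0, the invertible operator [A 0] vanishes, so the space is zero and coercivity holds
     with constant 1. *)
  have [a0|a0] := eqVneq a 0.
    have A0 : opnorm (A 0) = 0.
      apply: le_anti; rewrite opnorm_ge0 andbT -a0 /a.
      rewrite (bigD1 (Ordinal N0))//= lerDl sumr_ge0// => i _.
      exact: opnorm_ge0.
    apply: (@coercive_invertible _ _ _ 1) => // x.
    have -> : x = 0.
      rewrite -(bop_invl x (hA 0).2) [A 0 x](_ : _ = 0) ?linear0//.
      apply: rnorm_eq0; apply: le_anti; rewrite rnorm_ge0 andbT.
      by rewrite (le_trans (rnorm_opnorm _ _))// A0 mul0r.
    by rewrite linear0 /rinner linear0l rnorm0 expr0n mulr0.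
  have ap : 0 < a by rewrite lt_def a0 sumr_ge0// => i _; exact: opnorm_ge0.
  apply: (@coercive_invertible _ _ _ (s * (a / expR (2 * c)))) => [|x].
    by rewrite mulr_gt0// divr_gt0.
  rewrite bopZE rinnerZl -mulrA ler_pM2l// mulrAC ler_pdivrMr//.
  by rewrite [leRHS]mulrC.
split=> //; apply/OLC_leP => // x y; rewrite !bopZE !rnormZ ?(ltW s0)//.
rewrite -!mulrA [leRHS]mulrCA ler_pM2l//.
apply: le_trans (ler_wpM2r (rnorm_ge0 y) (Tle x)) _.
rewrite mulrAC [leRHS]mulrA ler_wpM2r ?rnorm_ge0//.
have Tn : a / expR (2 * c) * rnorm y <= rnorm (T y).
  by apply: rnorm_coercive; rewrite mulrAC ler_pdivrMr// [leRHS]mulrC.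
by move: Tn; rewrite mulrAC ler_pdivrMr// [leRHS]mulrC.
Qed.

End CesaroMean.

(* Passage to the limit for partial products and Cesàro means *)
Local Close Scope complex_scope.

(* A k is the operator A_(k+1), so that P N = A_1 A_2 ... A_N. *)
Theorem mainTheorem5 (R : realType) (H : hilbertType R) (A : nat -> bop H)
    (hA : forall k, Bpp (A k)) :
  let P (N : nat) : bop H := \prod_(k < N) A k in
  let S (N : nat) : bop H := (N%:R^-1 : R[i]) *: \sum_(k < N) A k in
  (forall Pinf : bop H, P N @[N --> \oo] --> Pinf -> invertible Pinf ->
     ((OLC Pinf)%:E <= limn_einf (fun N => (\sum_(k < N) OLC (A k))%:E))%E /\
     (cvgn (series (fun k => OLC (A k))) ->
        OLC Pinf <= limn (series (fun k => OLC (A k))))) /\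
  (forall N : nat, (0 < N)%N ->
     invertible (S N) /\
     OLC (S N) <= \big[Num.max/OLC (A 0%N)]_(k < N) OLC (A k)) /\
  (forall Ainf : bop H, S N @[N --> \oo] --> Ainf -> invertible Ainf ->
     ((OLC Ainf)%:E <= ereal_sup (range (fun k => (OLC (A k))%:E)))%E).
Proof.
move=> P S; have Ai k : invertible (A k) := (hA k).2.
have O0 k : 0 <= OLC (A k) := OLC_ge0 (Ai k).
pose s N := \sum_(k < N) OLC (A k).
have sS : {homo s : m n / (m <= n)%N >-> m <= n}.
  by apply/nondecreasing_seqP => n; rewrite /s big_ord_recr lerDl.
(* Serves both claims on products, with c the supremum or the limit of the partial sums; [s 0 = 0]
   gives c >= 0. *)
have Pbnd Pinf (c : R) : P N @[N --> \oo] --> Pinf -> invertible Pinf ->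
    (forall N, s N <= c) -> OLC Pinf <= c.
  move=> PP Pi sc; apply: (OLC_limit _ _ PP) => //.
    by rewrite (le_trans _ (sc 0))// /s big_ord0.
  apply: nearW => n; have [Pni Pn] := OLC_prod n Ai; split=> //.
  exact: le_trans Pn (sc n).
split=> [Pinf PP Pi|]; first split.
(* By monotonicity the lower limit is the supremum of the partial sums. If it is +oo nothing remains
   to prove, and -oo is excluded by the term at 0. *)
- have sE : {homo (fun N => (s N)%:E) : m n / (m <= n)%N >-> (m <= n)%E}.
    by move=> m n mn; rewrite lee_fin sS.
  have sC := ereal_nondecreasing_cvgn sE.
  rewrite (is_cvg_limn_einfE (cvgP _ sC)) (cvg_lim _ sC)//.
  have sub N : ((s N)%:E <= ereal_sup (range (fun N => (s N)%:E)))%E.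
    by apply: ereal_sup_ubound; exists N.
  case: (ereal_sup _) sub => [c| |] sub; last by have := sub 0.
    by rewrite lee_fin; apply: Pbnd => // N; rewrite -lee_fin.
  by rewrite leey.
- have -> : series (fun k => OLC (A k)) = s.
    by apply/funext => n; rewrite /series /= big_mkord.
  move=> sC; apply: Pbnd => // N; exact: nondecreasing_cvgn_le.
split=> [N N0|Ainf SA Ainfi].
  (* As 0 < N, the seed [OLC (A 0)] of the maximum is itself one of the terms. *)
  apply: OLC_cesaro_le hA _ _ => // k kN.
  exact: (le_bigmax_cond _ (fun i : 'I_N => OLC (A i)) (j := Ordinal kN)).
have sub k : ((OLC (A k))%:E <= ereal_sup (range (fun k => (OLC (A k))%:E)))%E.
  by apply: ereal_sup_ubound; exists k.
case: (ereal_sup _) sub => [c| |] sub; last by have := sub 0.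
  rewrite lee_fin; apply: (OLC_limit _ _ SA) => //.
    by rewrite (le_trans (O0 0))// -lee_fin.
  (* The index starts at 1 because [S 0] is the zero operator. *)
  exists 1 => // n /= n0; apply: OLC_cesaro_le hA _ _ => // k _.
  by rewrite -lee_fin.
by rewrite leey.
Qed.
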